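(* Let $E$ be a (real) Banach space and $\Phi = I_0 - I$, where $I \in C^1(E,\mathbb{R})$ and $I_0: E \to \mathbb{R}$ is a locally Lipschitz convex functional. Suppose that: (i) there exist $\rho > 0$ and $\alpha > \Phi(0)$ such that $\Phi(x) \geq \alpha$ for all $x \in \partial B_\rho(0)$; (ii) $\Phi(e) < \Phi(0)$ for some $e \in E \setminus \overline{B_\rho(0)}$. Let $$c = \inf_{\gamma \in \Gamma}\ \sup_{t \in [0,1]} \Phi(\gamma(t)), \qquad \Gamma = \{\gamma \in C^0([0,1],E) : \gamma(0) = 0 \text{ and } \gamma(1) = e\}.$$ Then $c \geq \alpha$, and for every $\epsilon > 0$ there exists $x_\epsilon \in E$ such that $$c - \epsilon < \Phi(x_\epsilon) < c + \epsilon$$ and $$I_0(y) - I_0(x_\epsilon) \geq I'(x_\epsilon)(y - x_\epsilon) - \epsilon\|y - x_\epsilon\| \quad \text{for all } y \in E.$$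
   Context: $B_\rho(0)$ is the open ball of radius $\rho$ centred at $0$ in $E$, $\partial B_\rho(0)$ its boundary sphere, and $I'(x) \in E^*$ denotes the Fréchet derivative of $I$ at $x$. *)

(* Defs.v *)
From HB Require Import structures.
From mathcomp Require Import all_boot all_order all_algebra.
From mathcomp Require Import all_classical all_reals all_analysis.

Set Implicit Arguments.
Unset Strict Implicit.
Unset Printing Implicit Defensive.

Import Order.TTheory GRing.Theory Num.Theory.
Import numFieldNormedType.Exports.

Local Open Scope classical_set_scope.
Local Open Scope ring_scope.

Section Defs.
Context {R : realType} {E : normedModType R}.

(* The norm of E^*. The real-valued [sup] is a genuine supremum as soon as
   [phi] is a continuous linear functional, the only case used below. *)
Definition dual_norm (phi : E -> R) : R :=
  sup [set `|phi v| | v in [set v : E | `|v| <= 1]].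

(* Frechet differentiable everywhere, with x |-> 'd f x continuous from E to
   E^* for the dual norm. *)
Definition C1 (f : E -> R) : Prop :=
  (forall x : E, differentiable f x) /\
  (forall x : E, dual_norm (fun v => 'd f y v - 'd f x v) @[y --> x] --> 0).

(* [locally [lipschitz f x | x in setT]] instead quantifies over
   neighbourhoods of arbitrary pairs (x, y), not only of diagonal ones. *)
Definition locally_lipschitz (f : E -> R) : Prop :=
  forall x : E, exists2 U : set E, nbhs x U & [lipschitz f y | y in U].

Definition boundary (A : set E) : set E := closure A `\` interior A.

(* Paths are total functions on R, of which only the restriction to [0, 1]
   matters. *)
Definition paths (x y : E) : set (R -> E) :=
  [set g : R -> E | [/\ {within `[0 : R, 1], continuous g}, g 0 = x & g 1 = y]].

(* For continuous F the inner sets are bounded, by compactness of [0, 1], and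
   the outer one is bounded below by F x, so [sup] and [inf] in R are genuine. *)
Definition minimax_level (F : E -> R) (x y : E) : R :=
  inf [set sup [set F (g t) | t in `[0 : R, 1]] | g in paths x y].

End Defs.

(* Main.v *)
Require Import Defs.
From HB Require Import structures.
From mathcomp Require Import all_boot all_order all_algebra.
From mathcomp Require Import all_classical all_reals all_analysis.
From mathcomp Require Import ring lra.

Set Implicit Arguments.
Unset Strict Implicit.
Unset Printing Implicit Defensive.

Import Order.TTheory GRing.Theory Num.Theory.
Import numFieldNormedType.Exports.

Local Open Scope classical_set_scope.
Local Open Scope ring_scope.

(** The minimax value [c] is at least [alpha] because every path from [0] to [e]
    crosses the sphere of radius [rho] (lemma [sphere_crossing]).

    For the almost critical point, let the height of a path be the supremum of
    [Phi] along it. With the uniform distance, the paths from [0] to [e] form a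
    complete metric space on which the height is lower semicontinuous and
    bounded below, so Ekeland's principle ([ekeland]) yields a path [g] of
    height [M < c + eps] that no other path undercuts at a rate of [eps / 4]
    per unit of distance. Some high point of [g] has the required property.
    Otherwise each high point [z = g t] has a witness [y] with
    [I0 y - I0 z < 'd I z (y - z) - eps * `|y - z|], and [g] can be pushed down
    too quickly, as follows.

    The witness inequality is open in [z], so one fixed [y] serves for all [t]
    close to a given one, and [y - g t], cut off by a bump function, is a
    continuous direction field. Convexity of [I0] shows that averages of such
    fields are again such fields, hence by compactness one field [w], with a
    weight [W >= `|w|], serves for all high points at once
    ([descent_field_compact]). Convexity also allows the field to be shortened,
    pointwise, by factors in [[0, 1]]; shortening to length at most [s], with
    weight exactly [s] at high points, gives a displacement along which the
    increase of [I0] is at most the linear part of the increase of [I], minus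
    [eps * s]. As [I] is [C1], its first-order expansion is uniform along the
    compact path, so for small [s] the remainder costs at most [eps / 2 * s].
    The path thus moves by at most [s] while [Phi] drops by [eps / 2 * s] at the
    high points and rises nowhere ([path_descent]). The endpoints stay fixed because they lie below the
    threshold: [Phi e < Phi 0 < alpha <= c <= M]. This contradicts the choice
    of [g]. *)

(** * Ekeland's variational principle *)

(** Descend greedily in the sets [S x] of points that improve on [x] by at least
    [eps] times their distance: the values decrease and are bounded below, which
    makes the sequence of points Cauchy, and nothing improves on its limit. The
    distance of [X] is only given through its balls, hence the radius [r] in
    place of a distance. The first hypothesis expresses both that [F] is lower
    semicontinuous on [A] and that limits do not leave [A]. *)
Lemma ekeland (R : realType) (X : completePseudoMetricType R) (A : set X)
    (F : X -> R) (m eps : R) (x0 : X) :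
    (forall a, closed [set x | A x /\ F x <= a]) ->
    (forall x, A x -> m <= F x) -> 0 < eps -> A x0 ->
  exists x, [/\ A x, F x <= F x0 &
    forall y r, A y -> 0 < r -> ball x r y -> F x <= F y + eps * r].
Proof.
move=> Fcl Fm eps0 Ax0.
pose S x := [set y | [/\ A y, F y <= F x &
  forall r, F x - F y < eps * r -> ball x r y]].
have Sxx x : A x -> S x x.
  move=> Ax; split=> // r; rewrite subrr pmulr_rgt0// => r0.
  exact: ballxx.
have Strans x y z : S x y -> S y z -> S x z.
  move=> [Ay Fyx Bxy] [Az Fzy Byz]; split=> //; first exact: le_trans Fyx.
  move=> r xzr.
  pose d := (eps * r - (F x - F z)) / 2.
  have d0 : 0 < d by rewrite /d; lra.
  have -> : r = (F x - F y + d) / eps + (F y - F z + d) / eps.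
    by rewrite /d; field; rewrite gt_eqF.
  apply: (@ball_triangle _ _ y).
    by apply: Bxy; rewrite mulrC divfK ?gt_eqF// /d; lra.
  by apply: Byz; rewrite mulrC divfK ?gt_eqF// /d; lra.
(* Go almost down to the infimum of [F] over [S x], within 1 / (n + 1). *)
have step (p : X * nat) : exists y, A p.1 -> S p.1 y /\
    forall z, S p.1 z -> F y <= F z + p.2.+1%:R^-1.
  case: p => x n /=; have [Ax|nAx] := pselect (A x); last by exists x.
  have Shi : has_inf (F @` S x).
    split; first by exists (F x), x => //; exact: Sxx.
    by exists m => _ [y [Ay _ _] <-]; exact: Fm.
  have n0 : 0 < n.+1%:R^-1 :> R by rewrite invr_gt0.
  have [_ [y Sy <-] yinf] := inf_adherent n0 Shi.
  exists y => _; split=> // z Sz; apply: (le_trans (ltW yinf)).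
  rewrite lerD2r; apply: ge_inf; last by exists z.
  exact: (proj2 Shi).
have [g gP] := choice step.
pose u := fix u n := if n is k.+1 then g (u k, k) else x0.
have Au n : A (u n).
  by elim: n => [//|n IH]/=; have [[]] := gP (u n, n) IH.
have uS n : S (u n) (u n.+1) by have [] := gP (u n, n) (Au n).
have uinf n z : S (u n) z -> F (u n.+1) <= F z + n.+1%:R^-1.
  by have [_] := gP (u n, n) (Au n); apply.
have uSle n k : S (u n) (u (n + k)%N).
  elim: k => [|k IH]; first by rewrite addn0; exact: Sxx.
  by rewrite addnS; exact: (Strans _ _ _ IH (uS _)).
have uSnm n k : (n <= k)%N -> S (u n) (u k).
  by move=> nk; rewrite -(subnKC nk).
have Fucvg : cvgn (F \o u).
  apply: nonincreasing_is_cvgn; last by exists m => _ [n _ <-]; exact: Fm.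
  by move=> n k nk /=; have [] := uSnm _ _ nk.
have : cvgn u.
  apply: cauchy_cvg; apply: cauchy_exP => e e0.
  have [n _ nP] : \forall n \near \oo, F (u n) - lim ((F \o u) @ \oo) < eps * e.
    near do rewrite ltrBlDl.
    by apply: (cvgr_lt _ Fucvg); rewrite ltrDl mulr_gt0.
  exists (u n); exists n => // k /= nk; have [_ _] := uSnm _ _ nk; apply.
  apply: le_lt_trans (nP n (leqnn n)); rewrite lerD2l lerN2.
  by apply: (nonincreasing_cvgn_ge _ Fucvg) => i j ij /=; have [] := uSnm _ _ ij.
move=> /cvg_ex[x ux].
have xle n : A x /\ F x <= F (u n).
  apply: (closed_cvg _ (Fcl (F (u n))) _ _ ux).
  by exists n => // k /= nk; split=> //; have [] := uSnm _ _ nk.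
have Ax := (xle 0%N).1.
(* [S] is not visibly closed, since balls are open: an intermediate radius
   absorbs the passage to the limit. *)
have Sux n : S (u n) x.
  split=> //; first exact: (xle n).2.
  move=> r xr.
  pose d := (r - (F (u n) - F x) / eps) / 2.
  have d0 : 0 < d.
    by rewrite /d divr_gt0// subr_gt0 ltr_pdivrMr// mulrC.
  have : \forall k \near \oo, ball (u k) d x /\ (n <= k)%N.
    near=> k; split; last by near: k; exists n.
    by apply: ball_sym; near: k; apply: cvg_ball.
  move=> [k _ /(_ _ (leqnn k))[kx nk]].
  have -> : r = r - d + d by rewrite subrK.
  apply: (@ball_triangle _ _ (u k)) => //.
  have [_ _] := uSnm _ _ nk; apply.
  have -> : r - d = (F (u n) - F x) / eps + d by rewrite /d; field; rewrite gt_eqF.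
  have := (xle k).2; have := mulr_gt0 eps0 d0.
  by rewrite mulrDr (mulrC eps (_ / eps)) divfK ?gt_eqF//; lra.
exists x; split=> //; first exact: (xle 0%N).2.
move=> y r Ay r0 xy; rewrite leNgt; apply/negP => lt.
have epsr := mulr_gt0 eps0 r0.
have Sxy : S x y.
  split=> //; first by lra.
  move=> r' r'P; apply: (le_ball _ xy).
  by rewrite -(ler_pM2l eps0); lra.
have Fxy : F x <= F y.
  apply/ler_addgt0Pr => e e0.
  have [n _ /(_ _ (leqnn n)) nP] : \forall n \near \oo, n.+1%:R^-1 < e.
    exact: near_infty_natSinv_lt (PosNum e0).
  apply: le_trans (xle n.+1).2 (le_trans (uinf _ _ (Strans _ _ _ (Sux n) Sxy)) _).
  by rewrite lerD2l; exact: ltW.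
lra.
Unshelve. all: by end_near.
Qed.

(** * First-order estimates for C1 functions *)

Section C1_functions.
Variables (R : realType) (E : normedModType R).
Implicit Types (f : E -> R) (x y z v h : E).

(** The codomain is pinned to the field so that rewriting does not mistake the
    scaling of vectors for the product of scalars. *)
Lemma diff_appZ f x (a : R) v : 'd f x (a *: v) = a * 'd f x v.
Proof. exact: linearZ. Qed.

Lemma diff_appD f x v h : 'd f x (v + h) = 'd f x v + 'd f x h.
Proof. exact: linearD. Qed.

(** Continuity is what makes the supremum defining [dual_norm] genuine: it
    bounds [phi] on the unit ball. *)
Lemma le_dual_norm (phi : {linear E -> R}) v :
  continuous phi -> `|phi v| <= dual_norm phi * `|v|.
Proof.
move=> /linear_bounded_continuous/bounded_funP/(_ 1)[M phiM].
have [->|v0] := eqVneq v 0; first by rewrite linear0 !normr0 mulr0.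
have nv0 : 0 < `|v| by rewrite normr_gt0.
rewrite -ler_pdivrMr//.
have -> : `|phi v| / `|v| = `|phi (`|v|^-1 *: v)|.
  by rewrite linearZ /= normrM gtr0_norm ?invr_gt0// mulrC.
apply: ub_le_sup; first by exists M => _ [w /= w1 <-]; exact: phiM.
by exists (`|v|^-1 *: v) => //=; rewrite normfZV.
Qed.

(** Continuity of the derivative for the dual norm, in the form in which it is
    used: near [x] the operator ['d f z - 'd f x] has norm at most [th]. *)
Lemma C1_diff_near f x th : C1 f -> 0 < th ->
  \forall z \near x, forall v, `|'d f z v - 'd f x v| <= th * `|v|.
Proof.
move=> [df cf] th0; have := cf x => /cvgrPdist_lt/(_ _ th0).
apply: filterS => z; rewrite sub0r normrN => zth v.
have [phi phiE] : exists phi : {linear E -> R},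
    phi = (fun v => 'd f z v - 'd f x v) :> (_ -> _).
  by exists ('d f z \- 'd f x).
have cphi : continuous phi.
  rewrite phiE => w; apply: cvgB; exact: diff_continuous.
rewrite -phiE in zth; have := le_dual_norm v cphi; rewrite {1}phiE.
move=> /le_trans; apply; rewrite ler_wpM2r//.
by apply: le_trans (ltW zth); rewrite ler_norm.
Qed.

Lemma C1_mean_value f z h : (forall x, differentiable f x) ->
  exists2 s, 0 <= s <= 1 & f (z + h) - f z = 'd f (z + s *: h) h.
Proof.
move=> df.
have dg s : is_derive s (1 : R) (fun t : R => f (z + t *: h)) ('d f (z + s *: h) h).
  have dk : is_diff s (cst z + *:%R ^~ h) ( *:%R ^~ h).
    by apply: is_diff_eq; rewrite add0r.
  have dfs : is_diff ((cst z + *:%R ^~ h) s) f ('d f (z + s *: h)).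
    by apply: DiffDef => //; exact: df.
  have dfk := is_diff_comp dk dfs.
  have -> : (fun t : R => f (z + t *: h)) = f \o (cst z + *:%R ^~ h) by [].
  split; first exact: diff_derivable.
  by rewrite deriveE// diff_val /= scale1r.
have [|s s01] := @MVT_segment R (fun t : R => f (z + t *: h))
    (fun s => 'd f (z + s *: h) h) 0 1 ler01.
  apply: continuous_subspaceT => s; apply/differentiable_continuous/derivable1_diffP.
  by have [] := dg s.
by rewrite scale1r scale0r addr0 subr0 mulr1 => ->; exists s; rewrite // -in_itv.
Qed.

(** The expansion is uniform in its base point [z] near [x]: by the mean value
    theorem the remainder is ['d f xi h - 'd f z h] for some [xi] between [z]
    and [z + h], and both differentials are within [th / 2] of ['d f x]. *)
Lemma C1_remainder f x th : C1 f -> 0 < th ->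
  exists2 r, 0 < r & forall z h, ball x r z -> `|h| < r ->
    `|f (z + h) - f z - 'd f z h| <= th * `|h|.
Proof.
move=> C1f th0.
have th20 : 0 < th / 2 by rewrite divr_gt0.
have /nbhs_ballP[r /= r0 xr] := C1_diff_near x C1f th20.
exists (r / 2); first by rewrite divr_gt0.
move=> z h xz hr; have [s /andP[s0 s1] ->] := C1_mean_value z h (proj1 C1f).
have zr : ball x r z by apply: le_ball xz; lra.
have szr : ball x r (z + s *: h).
  move: xz; rewrite -!ball_normE/= => xz.
  rewrite opprD addrA (le_lt_trans (ler_normB _ _))// normrZ ger0_norm//.
  have : s * `|h| <= 1 * `|h| by rewrite ler_wpM2r.
  lra.
have := xr _ zr h; have := xr _ szr h => /= A B.
rewrite (_ : _ - _ = ('d f (z + s *: h) h - 'd f x h) - ('d f z h - 'd f x h)).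
  by apply: le_trans (ler_normB _ _) _; lra.
by ring.
Qed.

(** Strong continuity of [z |-> 'd f z] is what allows its argument to vary
    along with [z]. *)
Lemma C1_diff_app_continuous f (k : E -> E) : C1 f -> continuous k ->
  continuous (fun z => 'd f z (k z)).
Proof.
move=> C1f ck x.
have -> : (fun z => 'd f z (k z)) =
  (fun z => ('d f z (k z) - 'd f x (k z)) + 'd f x (k z)).
  by apply/funext => z; rewrite subrK.
rewrite /continuous_at; apply: cvgD; last first.
  apply: continuous_comp; first exact: ck.
  exact: diff_continuous (C1f.1 x) _.
rewrite subrr; apply/cvgrPdist_le => e e0.
have d0 : 0 < e / (`|k x| + 1) by rewrite divr_gt0// ltr_wpDl.
have := C1_diff_near x C1f d0; rewrite !near_simpl => H.
near=> z; rewrite sub0r normrN.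
apply: (@le_trans _ _ (e / (`|k x| + 1) * `|k z|)).
  by move: (k z); near: z; exact: H.
rewrite mulrAC ler_pdivrMr ?ltr_wpDl// ler_pM2l//.
near: z; apply: (cvgr_le `|k x|); last by rewrite ltrDl.
exact: cvg_norm (ck x).
Unshelve. all: by end_near.
Qed.

End C1_functions.

(** * From local to global on compact sets *)

(** Compactness as an induction principle. The sets [S] with
    [P (K `\` S)] form a filter by the closure
    properties of [P]. If [P K] failed, this filter would be proper and hence
    cluster at some [x] in [K], which the neighbourhood of [x] with property [P]
    forbids. *)
Lemma compact_set_ind (T : topologicalType) (K : set T) (P : set T -> Prop) :
    compact K -> P set0 ->
    (forall A B : set T, A `<=` B -> P B -> P A) ->
    (forall A B : set T, P A -> P B -> P (A `|` B)) ->
    (forall x, K x -> exists2 V, nbhs x V & P V) ->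
  P K.
Proof.
move=> cK P0 Psub PU Ploc; apply: contrapT => nPK.
pose G : set_system T := [set S | P (K `\` S)].
have GF : ProperFilter G.
  apply: Build_ProperFilter_ex => [S GS|].
    apply: contrapT => S0; apply: nPK; move: GS; rewrite /G/=; apply: Psub => x Kx.
    by split=> // Sx; apply: S0; exists x.
  split.
  - by rewrite /G /= setDT.
  - by move=> A B GA GB; rewrite /G/= setDIr; exact: PU.
  - by move=> A B AB; apply: Psub => x [Kx nBx]; split=> // /AB.
have [x [Kx clx]] : K `&` cluster G !=set0.
  by apply: cK; rewrite /G/= setDv.
have [V xV PV] := Ploc x Kx.
have : G (~` V) by apply: Psub PV => y [_ /contrapT].
by move=> /clx/(_ xV) [y []].
Qed.

(** * Pushing a path down *)

Section descent_along_a_path.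
Variables (R : realType) (E : normedModType R) (I0 I : E -> R) (g : R -> E).
Hypotheses (I0c : continuous I0) (I0cvx : convex_function [set: E] I0).
Hypotheses (C1I : C1 I) (gc : continuous g).
Implicit Types (eps : R) (U S J K : set R).

Lemma convex_function_segment x y (t : R) : 0 <= t <= 1 ->
  I0 (x + t *: (y - x)) <= I0 x + t * (I0 y - I0 x).
Proof.
move=> /andP[t0 t1].
have t01 : Itv.spec (Itv.num_sem (R:=R)) (Itv.Real `[0%Z, 1%Z]) t.
  by rewrite /= /Itv.num_sem/= num_real/= in_itv/= t0 t1.
have := I0cvx (Itv.mk t01) (mem_set (Logic.I : [set: E] y))
  (mem_set (Logic.I : [set: E] x)).
have -> : conv (Itv.mk t01) (y : convex_lmodType E) (x : convex_lmodType E) =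
    x + t *: (y - x).
  change (t *: y + (1 - t) *: x = x + t *: (y - x)).
  by rewrite scalerBr scalerBl scale1r addrCA.
move=> /le_trans; apply.
change (t * I0 y + (1 - t) * I0 x <= I0 x + t * (I0 y - I0 x)); lra.
Qed.

(** The weight [W] stands in for [`|w|], which cannot be used itself: the norm
    of an average of two fields may drop, even to [0], whereas the average of
    their weights still bounds it and still measures the decrease of [I0]. The
    last clause only speaks of the full step [w]; convexity of [I0] extends it
    to shorter ones. *)
Definition descent_field eps U S (w : R -> E) (W : R -> R) :=
  [/\ continuous w, continuous W,
      (forall t, `|w t| <= W t) /\ (forall t, ~ U t -> W t = 0),
      (forall t, S t -> 0 < W t) &
      forall t, I0 (g t + w t) - I0 (g t) <= 'd I (g t) (w t) - eps * W t].

Lemma descent_field0 eps U : exists w W, descent_field eps U set0 w W.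
Proof.
exists (cst 0), (cst 0); split=> //.
- by move=> t; exact: cvg_cst.
- by move=> t; exact: cvg_cst.
- by split=> // t /=; rewrite normr0.
- by move=> t /=; rewrite addr0 subrr linear0 mulr0 subrr.
Qed.

(** [g + (w1 + w2) / 2] is the midpoint of [g + w1] and [g + w2], so convexity
    of [I0] averages the two decrease estimates, whose right-hand sides are linear
    in the field and in the weight. *)
Lemma descent_fieldU eps U S1 S2 w1 W1 w2 W2 :
    descent_field eps U S1 w1 W1 -> descent_field eps U S2 w2 W2 ->
  descent_field eps U (S1 `|` S2)
    (fun t => 2^-1 *: (w1 t + w2 t)) (fun t => 2^-1 * (W1 t + W2 t)).
Proof.
move=> [cw1 cW1 [wW1 W10] W1S d1] [cw2 cW2 [wW2 W20] W2S d2]; split.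
- move=> t; apply: cvgZ; first exact: cvg_cst.
  by apply: cvgD; [exact: cw1|exact: cw2].
- move=> t; apply: cvgM; first exact: cvg_cst.
  by apply: cvgD; [exact: cW1|exact: cW2].
- split=> t; last by move=> Ut; rewrite W10// W20// addr0 mulr0.
  rewrite normrZ gtr0_norm ?invr_gt0// ler_pM2l ?invr_gt0//.
  by apply: le_trans (ler_normD _ _) _; exact: lerD.
- have ge1 t : 0 <= W1 t by apply: le_trans (wW1 t).
  have ge2 t : 0 <= W2 t by apply: le_trans (wW2 t).
  move=> t [/W1S|/W2S] W0; rewrite mulr_gt0 ?invr_gt0//.
    by have := ge2 t; lra.
  by have := ge1 t; lra.
- move=> t /=.
  rewrite diff_appZ diff_appD.
  have -> : g t + 2^-1 *: (w1 t + w2 t) =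
      (g t + w1 t) + 2^-1 *: ((g t + w2 t) - (g t + w1 t)).
    rewrite opprD addrACA subrr add0r -addrA; congr (_ + _).
    rewrite scalerBr scalerDr addrCA -{2}[w1 t]scale1r -scalerBl.
    by rewrite (_ : 1 - 2^-1 = 2^-1) 1?[RHS]addrC//; lra.
  have := @convex_function_segment (g t + w1 t) (g t + w2 t) 2^-1.
  have := d1 t; have := d2 t.
  have h01 : 0 <= (2^-1 : R) <= 1 by apply/andP; split; lra.
  move=> A B /(_ h01) C; lra.
Qed.

(** The hypothesis is open in the point of the path, so the single witness [y]
    remains valid for [t] near [t0]. There [w t] points from [g t] towards [y],
    and a tent function [p] cuts it off. *)
Lemma descent_field_local eps U t0 y : open U -> U t0 ->
    I0 y - I0 (g t0) < 'd I (g t0) (y - g t0) - eps * `|y - g t0| ->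
  exists2 S, nbhs t0 S & exists w W, descent_field eps U S w W.
Proof.
move=> oU Ut0 yt0.
pose k t := I0 y - I0 (g t) - ('d I (g t) (y - g t) - eps * `|y - g t|).
have yg : continuous (fun t => y - g t).
  by move=> t; apply: cvgB; [exact: cvg_cst|exact: gc].
have kc : continuous k.
  move=> t; apply: cvgB.
    apply: cvgB; first exact: cvg_cst.
    by apply: continuous_comp; [exact: gc|exact: I0c].
  apply: cvgB; last by apply: cvgM; first exact: cvg_cst; apply: cvg_norm; exact: yg.
  apply: (@continuous_comp _ _ _ g (fun z => 'd I z (y - z))); first exact: gc.
  apply: (C1_diff_app_continuous C1I) => z.
  by apply: cvgB; [exact: cvg_cst|exact: cvg_id].
have : \forall t \near t0, U t /\ k t < 0.
  apply: filterI; first exact: open_nbhs_nbhs.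
  have kt0 : k t0 < 0 by rewrite subr_lt0.
  exact: (cvgr_lt (k t0) (kc t0) _ kt0).
move=> /nbhs_ballP[d /= d0 dU].
pose p t : R := Num.max 0 (1 - `|t - t0| / d).
have p01 t : 0 <= p t <= 1.
  by rewrite /p le_max lexx ge_max ler01/= gerBl divr_ge0// ltW.
have pU t : p t != 0 -> U t /\ k t < 0.
  move=> pt; apply: dU; rewrite -ball_normE/= distrC ltNge; apply/negP => dt.
  move/eqP : pt; apply; apply/max_idPl; rewrite subr_le0.
  by rewrite ler_pdivlMr// mul1r.
have pc : continuous p.
  move=> t; apply: (@continuous_max _ _ (cst 0) (fun t => 1 - `|t - t0| / d)).
    exact: cvg_cst.
  apply: cvgB; first exact: cvg_cst.
  apply: cvgM; last exact: cvg_cst.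
  by apply: cvg_norm; apply: cvgB; [exact: cvg_id|exact: cvg_cst].
exists (ball t0 d); first exact: nbhsx_ballx.
exists (fun t => p t *: (y - g t)), (fun t => p t * `|y - g t|); split.
- by move=> t; apply: cvgZ; [exact: pc|exact: yg].
- by move=> t; apply: cvgM; [exact: pc|apply: cvg_norm; exact: yg].
- split=> t; first by rewrite normrZ ger0_norm//; have /andP[] := p01 t.
  move=> nU; have [->|/pU[]//] := eqVneq (p t) 0; by rewrite mul0r.
- move=> t td; rewrite mulr_gt0//.
    rewrite /p lt_max subr_gt0 ltr_pdivrMr// mul1r.
    by move: td; rewrite -ball_normE/= distrC => ->; rewrite orbT.
  (* The strict inequality [k t < 0] would read [0 < 0] if [y] were [g t]. *)
  rewrite normr_gt0 subr_eq0; apply/eqP => yt.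
  by have [_] := dU _ td; rewrite /k yt !subrr linear0 normr0 mulr0 !subrr ltxx.
- move=> t; have /andP[p0 p1] := p01 t.
  apply: (@le_trans _ _ (p t * (I0 y - I0 (g t)))).
    by rewrite lerBlDl; exact: convex_function_segment (p01 t).
  have [->|/pU[_]] := eqVneq (p t) 0.
    by rewrite !mul0r scale0r linear0 mulr0 subrr.
  rewrite /k subr_lt0 => /ltW kt.
  by rewrite diff_appZ [eps * _]mulrCA -mulrBr; exact: ler_wpM2l.
Qed.

Lemma compact_pos_lb K (W : R -> R) : compact K -> continuous W ->
  (forall t, K t -> 0 < W t) -> exists2 m, 0 < m & forall t, K t -> m <= W t.
Proof.
move=> cK cW W0.
apply: (compact_set_ind
  (P := fun S => exists2 m, 0 < m & forall t, S t -> m <= W t) cK).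
- by exists 1.
- by move=> A B AB [m m0 Bm]; exists m => // t /AB /Bm.
- move=> A B [m m0 Am] [n n0 Bn]; exists (Num.min m n); first by rewrite lt_min m0.
  by move=> t [/Am|/Bn] h; rewrite ge_min h ?orbT.
- move=> t Kt; exists [set s | W t / 2 <= W s]; last first.
    by exists (W t / 2) => //; rewrite divr_gt0// W0.
  have Wt : W t / 2 < W t by have := W0 _ Kt; lra.
  exact: (cvgr_ge (W t) (cW t) _ Wt).
Qed.

Lemma descent_field_compact eps U K : open U -> compact K -> K `<=` U ->
    (forall t, K t -> exists y,
      I0 y - I0 (g t) < 'd I (g t) (y - g t) - eps * `|y - g t|) ->
  exists w W, descent_field eps U K w W.
Proof.
move=> oU cK KU ex.
apply: (compact_set_ind (P := fun S => exists w W, descent_field eps U S w W) cK).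
- exact: descent_field0.
- move=> A B AB [w [W [? ? ? WB ?]]]; exists w, W; split=> // t /AB; exact: WB.
- move=> A B [w1 [W1 d1]] [w2 [W2 d2]]; do 2!eexists; exact: descent_fieldU d1 d2.
- move=> t Kt; have [y] := ex _ Kt; exact: descent_field_local (KU _ Kt).
Qed.

Lemma compact_C1_remainder K th : compact K -> 0 < th ->
  exists2 r, 0 < r & forall t h, K t -> `|h| < r ->
    `|I (g t + h) - I (g t) - 'd I (g t) h| <= th * `|h|.
Proof.
move=> cK th0.
apply: (compact_set_ind (P := fun S => exists2 r, 0 < r &
  forall t h, S t -> `|h| < r ->
    `|I (g t + h) - I (g t) - 'd I (g t) h| <= th * `|h|) cK).
- by exists 1.
- by move=> A B AB [m m0 Bm]; exists m => // t h /AB /Bm; apply.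
- move=> A B [m m0 Am] [n n0 Bn]; exists (Num.min m n); first by rewrite lt_min m0.
  by move=> t h [/Am|/Bn] H; rewrite lt_min => /andP[? ?]; exact: H.
- move=> t Kt; have [r r0 rP] := C1_remainder (g t) C1I th0.
  exists (g @^-1` ball (g t) r); last by exists r => // s h; exact: rP.
  by apply: gc; exact: nbhsx_ballx.
Qed.

(** Shorten the field obtained by compactness so that its weight is at most [s]
    everywhere and equal to [s] on [K]. Half of the decrease rate [eps] is spent
    on the remainder of [I], which is uniformly small on the compact set [J].
    The decrease is wanted on [K], and [U] confines the change of the path. *)
Lemma path_descent eps U K J : 0 < eps -> open U -> compact K -> K `<=` U ->
    compact J ->
    (forall t, K t -> exists y,
      I0 y - I0 (g t) < 'd I (g t) (y - g t) - eps * `|y - g t|) ->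
  \forall s \near 0^'+, exists eta : R -> E,
    [/\ continuous eta, forall t, `|eta t - g t| <= s,
        forall t, ~ U t -> eta t = g t,
        forall t, J t -> I0 (eta t) - I (eta t) <= I0 (g t) - I (g t) &
        forall t, J t -> K t ->
          I0 (eta t) - I (eta t) <= I0 (g t) - I (g t) - eps / 2 * s].
Proof.
move=> eps0 oU cK KU cJ ex.
have [w [W [cw cW [wW W0] WK dW]]] := descent_field_compact oU cK KU ex.
have [m m0 mW] := compact_pos_lb cK cW WK.
have e20 : 0 < eps / 2 by rewrite divr_gt0.
have [r r0 rP] := compact_C1_remainder cJ e20.
near=> s.
have s0 : 0 < s by near: s; exact: nbhs_right_gt.
have sm : s <= m by near: s; exact: nbhs_right_le.
have sr : s < r by near: s; exact: nbhs_right_lt.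
(* Dividing by [W] alone would normalise the field but is impossible where [W]
   vanishes; the lower bound [m] of [W] on [K] repairs this without changing
   anything on [K]. *)
pose l t := s / Num.max m (W t).
have max0 t : 0 < Num.max m (W t) by rewrite lt_max m0.
have l01 t : 0 <= l t <= 1.
  apply/andP; split; first exact: divr_ge0 (ltW s0) (ltW (max0 t)).
  by rewrite /l ler_pdivrMr// mul1r le_max sm.
have lW t : l t * W t <= s.
  by rewrite /l mulrAC ler_pdivrMr// ler_pM2l// le_max lexx orbT.
have lwW t : `|l t *: w t| <= l t * W t.
  have /andP[l0 _] := l01 t.
  by rewrite normrZ ger0_norm// ler_wpM2l.
have cl : continuous l.
  move=> t; apply: cvgM; first exact: cvg_cst; apply: cvgV; first by rewrite gt_eqF.
  by apply: (@continuous_max _ _ (cst m) W); [exact: cvg_cst|exact: cW].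
have desc t : J t ->
  I0 (g t + l t *: w t) - I (g t + l t *: w t) <=
    I0 (g t) - I (g t) - eps / 2 * (l t * W t).
  move=> Jt; have /andP[l0 l1] := l01 t.
  have := rP t (l t *: w t) Jt (le_lt_trans (le_trans (lwW t) (lW t)) sr).
  rewrite ler_norml => /andP[+ _]; rewrite diff_appZ.
  have /ler_wpM2l/(_ _ _ (lwW t)) := ltW e20.
  have /ler_wpM2l/(_ _ _ (dW t)) := l0.
  have := convex_function_segment (g t) (g t + w t) (l01 t).
  rewrite [_ + w t]addrC addrK.
  have -> : l t * ('d I (g t) (w t) - eps * W t) =
    l t * 'd I (g t) (w t) - eps * (l t * W t) by ring.
  lra.
exists (fun t => g t + l t *: w t); split.
- by move=> t; apply: cvgD; [exact: gc|apply: cvgZ; [exact: cl|exact: cw]].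
- by move=> t; rewrite addrC addKr; exact: le_trans (lwW t) (lW t).
- move=> t /W0 Wt; have := wW t; rewrite Wt normr_le0 => /eqP ->.
  by rewrite scaler0 addr0.
- move=> t Jt; apply: le_trans (desc t Jt) _; rewrite gerBl.
  exact: mulr_ge0 (ltW e20) (le_trans (normr_ge0 _) (lwW t)).
- move=> t Jt Kt; apply: le_trans (desc t Jt) _; rewrite lerD2l lerN2 ler_pM2l//.
  by rewrite /l (max_idPr (mW _ Kt)) divfK// gt_eqF// WK.
Unshelve. all: by end_near.
Qed.

End descent_along_a_path.

(** * The metric space of paths *)

(** Functions into a complete space thus form a complete pseudometric space for
    uniform convergence: the base point is the one ingredient to be supplied. *)
HB.instance Definition _ (T : choiceType) (R : realType)
  (U : completePseudoMetricType R) := Pointed.on (arrow_uniform_type T U).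

Section pinned_paths.
Variables (R : realType) (E : completeNormedModType R).
Implicit Types (F : E -> R) (x y : E) (g : R -> E).

Lemma locally_lipschitz_continuous F : locally_lipschitz F -> continuous F.
Proof.
move=> lipF x; have [U xU /pinfty_ex_gt0[M M0 FM]] := lipF x.
apply/cvgrPdist_le => e e0; near=> z.
apply: (@le_trans _ _ (M * `|x - z|)).
  apply: (FM (x, z)); split => /=; last by near: z.
  exact: nbhs_singleton.
rewrite mulrC -ler_pdivlMr//; near: z.
by apply: cvgr_dist_le; [exact: cvg_id|rewrite divr_gt0].
Unshelve. all: by end_near. Qed.

(** Paths extended by constants outside [[0, 1]]. Each path on [[0, 1]] has one
    such extension, so uniform distance over the whole line is uniform distance
    over [[0, 1]], and continuity needs no restriction to a subspace. *)
Definition pinned x y : set (arrow_uniform_type R E) :=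
  [set g : R -> E | [/\ continuous g, forall t, t <= 0 -> g t = x &
    forall t, 1 <= t -> g t = y]].

Definition path_height F g : R := sup [set F (g t) | t in `[0 : R, 1]].

Definition clamp (t : R) : R := Num.max 0 (Num.min 1 t).

Lemma clamp_itv t : clamp t \in `[0, 1].
Proof. by rewrite in_itv/= /clamp le_max lexx/= ge_max ler01 ge_min lexx. Qed.

Lemma clamp_id t : t \in `[0, 1] -> clamp t = t.
Proof.
by rewrite in_itv/= => /andP[t0 t1]; rewrite /clamp (min_idPr t1) (max_idPr t0).
Qed.

Lemma clamp_continuous : continuous clamp.
Proof.
rewrite /clamp => t; apply: (@continuous_max _ R (cst 0) (fun t : R => Num.min 1 t)).
  exact: cvg_cst.
apply: (@continuous_min _ R (cst 1) id); [exact: cvg_cst|exact: cvg_id].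
Qed.

Lemma pinned_paths x y g : pinned x y g -> paths x y g.
Proof.
by move=> [cg g0 g1]; split; [exact: continuous_subspaceT|exact: g0|exact: g1].
Qed.

Lemma paths_clamp x y g : paths x y g -> pinned x y (g \o clamp).
Proof.
move=> [/subspace_continuousP cg g0 g1]; split.
- move=> t; apply: cvg_comp (cg _ (clamp_itv t)) => B wB.
  have := @clamp_continuous t _ wB; rewrite /= !near_simpl.
  by apply: filterS => s /=; apply; exact: clamp_itv.
- move=> t t0 /=; rewrite /clamp -g0; congr g; apply/max_idPl.
  by rewrite ge_min t0 orbT.
- move=> t t1 /=; rewrite /clamp -g1; congr g.
  by rewrite (min_idPl t1); apply/max_idPr.
Qed.

Lemma path_height_clamp F g : path_height F (g \o clamp) = path_height F g.
Proof.
congr sup; apply/seteqP; split=> _ [t t01 <-].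
- by exists t => //=; rewrite clamp_id.
- by exists t => //=; rewrite clamp_id.
Qed.

Lemma path_height_ub F x y g t : continuous F -> paths x y g ->
  t \in `[0, 1] -> F (g t) <= path_height F g.
Proof.
move=> cF [cg _ _] t01; apply: ub_le_sup; last by exists t.
apply: (proj2 (compact_has_sup _ _)); first by exists (F (g t)), t.
apply: (@continuous_compact _ _ (F \o g)); last exact: segment_compact.
by apply: within_continuous_comp cg => z _; exact: cF.
Qed.

Lemma path_height_le F g a : (forall t, t \in `[0, 1] -> F (g t) <= a) ->
  path_height F g <= a.
Proof.
move=> Fa; apply: ge_sup; last by move=> _ [t t01 <-]; exact: Fa.
by exists (F (g 0)), 0 => //=; rewrite in_itv/= lexx ler01.
Qed.

(** Uniform limits preserve continuity and pointwise constraints; an upper bound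
    on the height is such a constraint, [F (g t) <= a] for each [t], because [F]
    is continuous. *)
Lemma closed_path_height_sublevel F x y a : continuous F ->
  closed [set g : arrow_uniform_type R E | pinned x y g /\ path_height F g <= a].
Proof.
move=> cF g clg.
have near_g r : 0 < r -> exists h : R -> E,
    [/\ pinned x y h, path_height F h <= a & forall t, `|g t - h t| < r].
  move=> r0; have [h [[hP ha] gh]] := clg _ (nbhsx_ballx g r r0).
  exists h; split=> // t; have := gh t; by rewrite -ball_normE.
have lim_eq t z : (forall h, pinned x y h -> h t = z) -> g t = z.
  move=> hz; apply/eqP; rewrite -subr_eq0 -normr_le0; apply/ler_addgt0Pr => r r0.
  by have [h [/hz <- _ /(_ t)/ltW]] := near_g r r0; rewrite add0r.
split; first split.
- move=> t; apply/cvgrPdist_lt => e e0.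
  have e30 : 0 < e / 3 by rewrite divr_gt0.
  have [h [[ch _ _] _ gh]] := near_g _ e30.
  have /cvgrPdist_lt/(_ _ e30) := ch t; apply: filterS => s hts.
  have -> : g t - g s = (g t - h t) + (h t - h s) - (g s - h s).
    by rewrite subrKA opprB addrA subrK.
  apply: le_lt_trans (ler_normB _ _) _.
  have := ler_normD (g t - h t) (h t - h s); have := gh t; have := gh s; lra.
- by move=> t t0; apply: lim_eq => h [_ + _]; apply.
- by move=> t t1; apply: lim_eq => h [_ _]; apply.
- apply: path_height_le => t t01; rewrite leNgt; apply/negP => aF.
  have : nbhs (g t) [set z | a < F z] by exact: cvgr_gt (cF (g t)) _ aF.
  move=> /nbhs_ballP[r /= r0 rF].
  have [h [/pinned_paths hP ha gh]] := near_g _ r0.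
  have /= := rF (h t); rewrite -ball_normE => /(_ (gh t)).
  by rewrite ltNge (le_trans (path_height_ub cF hP t01)).
Qed.

(** The closed ball is the closure of the open one, so [e] has norm above [rho]
    and the intermediate value theorem applies to the norm along the path. *)
Lemma sphere_crossing (rho : R) e g : 0 < rho -> ~ closure (ball (0 : E) rho) e ->
  paths 0 e g -> exists2 t, t \in `[0, 1] & boundary (ball (0 : E) rho) (g t).
Proof.
move=> rho0 he [cg g0 g1].
have clE z : closure (ball (0 : E) rho) z <-> `|z| <= rho.
  rewrite -[closure _]/(closed_ball 0 rho) closed_ballE// /closed_ball_/=.
  by rewrite sub0r normrN.
have rho1 : rho < `|e| by rewrite ltNge; apply/negP => /clE.
have cng : {within `[0, 1], continuous (fun t => `|g t|)}.
  by apply: (@within_continuous_comp _ _ _ _ g Num.norm) cg => z _; exact: norm_continuous.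
have [|t t01 gt] := IVT ler01 cng (v := rho).
  by rewrite g0 g1 normr0 ge_min le_max (ltW rho0) (ltW rho1) orbT.
exists t => //; split; first by apply/clE; rewrite gt.
have /interior_id -> : open (ball (0 : E) rho) by exact: ball_open.
by rewrite -ball_normE/= sub0r normrN gt ltxx.
Qed.

End pinned_paths.

(** * The mountain pass theorem *)

Lemma segment_paths (R : realType) (E : normedModType R) (x y : E) :
  paths x y (fun t : R => x + t *: (y - x)).
Proof.
split; last 2 first.
- by rewrite scale0r addr0.
- by rewrite scale1r addrC subrK.
apply: continuous_subspaceT => t; apply: cvgD; first exact: cvg_cst.
by apply: cvgZ; [exact: cvg_id|exact: cvg_cst].
Qed.

Theorem theorem1p4 (R : realType) (E : completeNormedModType R)
    (Phi I0 I : E -> R) (hPhi : Phi = (fun x => I0 x - I x))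
    (hI : C1 I)
    (hI0lip : locally_lipschitz I0) (hI0cvx : convex_function [set: E] I0)
    (rho alpha : R) (hrho : 0 < rho) (halpha : Phi 0 < alpha)
    (hsphere : forall x : E, boundary (ball (0 : E) rho) x -> alpha <= Phi x)
    (e : E) (he : ~ closure (ball (0 : E) rho) e) (hPhie : Phi e < Phi 0) :
  let c := minimax_level Phi 0 e in
  alpha <= c /\
  forall eps : R, 0 < eps ->
    exists x : E,
      c - eps < Phi x < c + eps /\
      forall y : E, 'd I x (y - x) - eps * `|y - x| <= I0 y - I0 x.
Proof.
move=> c.
have I0c : continuous I0 := locally_lipschitz_continuous hI0lip.
have Ic : continuous I by move=> x; apply: differentiable_continuous; exact: hI.1.
have Phic : continuous Phi.
  by rewrite hPhi => x; apply: cvgB; [exact: I0c|exact: Ic].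
have alpha_height g : paths 0 e g -> alpha <= path_height Phi g.
  move=> gP; have [t t01 tS] := sphere_crossing hrho he gP.
  exact: le_trans (hsphere _ tS) (path_height_ub Phic gP t01).
have paths0 : [set path_height Phi g | g in paths 0 e] !=set0.
  by eexists; eexists; [exact: segment_paths|reflexivity].
have lb_heights : lbound [set path_height Phi g | g in paths 0 e] alpha.
  by move=> _ [g gP <-]; exact: alpha_height.
have c_height g : paths 0 e g -> c <= path_height Phi g.
  by move=> gP; apply: ge_inf; [exists alpha|exists g].
have alpha_c : alpha <= c by exact: lb_le_inf.
split=> // eps eps0.
have [_ [g0 g0P <-] g0c] :
    exists2 h, [set path_height Phi g | g in paths 0 e] h & h < c + eps.
  by apply: inf_adherent => //; split=> //; exists alpha.
have e40 : 0 < eps / 4 by rewrite divr_gt0.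
have [g [gP gg0 gmin]] := @ekeland R (arrow_uniform_type R E) (pinned 0 e)
  (path_height Phi) alpha (eps / 4) _
  (fun a => closed_path_height_sublevel (x := 0) (y := e) (a := a) Phic)
  (fun h hP => alpha_height h (pinned_paths hP)) e40 (paths_clamp g0P).
rewrite path_height_clamp in gg0.
have gpath := pinned_paths gP.
have [gc gl gr] := gP.
set M := path_height Phi g in gg0 gmin.
have cM : c <= M := c_height _ gpath.
(* Above [a] a point of [g] lies in the required band; and [a >= Phi 0 > Phi e]
   keeps the endpoints out of the set [U] where the path is changed. *)
pose a := Num.max (c - eps) (Phi 0).
have aM : a < M by rewrite gt_max; apply/andP; split; lra.
apply: contrapT => noncritical.
(* The gap between [a] and [b] separates the compact [K] from the complement of
   [U]; the gap between [b] and [M] leaves room for points outside [K]. *)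
pose b := (a + M) / 2.
have ab : a < b by rewrite /b; lra.
have bM : b < M by rewrite /b; lra.
pose U := [set t | a < Phi (g t)].
pose J := [set` `[0 : R, 1]].
pose K := J `&` [set t | b <= Phi (g t)].
have Phigc : continuous (Phi \o g).
  by move=> t; apply: continuous_comp; [exact: gc|exact: Phic].
have oU : open U.
  by apply: (open_comp (f := Phi \o g) (D := [set z | a < z])) => //; exact: open_gt.
have cJ : compact J by exact: segment_compact.
have cK : compact K.
  apply: compact_closedI cJ _.
  by apply: (preimage_closed (f := Phi \o g) (D := [set z | b <= z])) => //; exact: closed_ge.
have KU : K `<=` U by move=> t [_]; exact: lt_le_trans.
have slope t : K t -> exists y,
    I0 y - I0 (g t) < 'd I (g t) (y - g t) - eps * `|y - g t|.
  move=> [t01 bt]; apply: contrapT => nexy; apply: noncritical.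
  exists (g t); split; last first.
    by move=> y; rewrite leNgt; apply/negP => lty; apply: nexy; exists y.
  have := path_height_ub Phic gpath t01; rewrite -/M => tM.
  have : c - eps <= a by rewrite le_max lexx.
  have {}bt : b <= Phi (g t) := bt.
  move=> ca; apply/andP; split; lra.
have desc := path_descent I0c hI0cvx hI gc eps0 oU cK KU cJ slope.
near (0 : R)^'+ => s.
have s0 : 0 < s by near: s; exact: nbhs_right_gt.
have sb : s <= (M - b) / eps.
  by near: s; apply: nbhs_right_le; rewrite divr_gt0// subr_gt0.
have [eta [etac etag etaU etaJ etaK]] : exists eta : R -> E,
    [/\ continuous eta, forall t, `|eta t - g t| <= s,
        forall t, ~ U t -> eta t = g t,
        forall t, J t -> I0 (eta t) - I (eta t) <= I0 (g t) - I (g t) &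
        forall t, J t -> K t ->
          I0 (eta t) - I (eta t) <= I0 (g t) - I (g t) - eps / 2 * s].
  by near: s.
have etaP : pinned 0 e eta.
  split=> // t t01; rewrite etaU; [exact: gl| |exact: gr|].
    by rewrite /U/= gl// => /lt_geF; rewrite le_max lexx orbT.
  rewrite /U/= gr// => /lt_trans/(_ hPhie)/lt_geF.
  by rewrite le_max lexx orbT.
(* Balls are open, so the radius must exceed [s]; with rate [eps / 4] any
   factor between 1 and 2 still contradicts the drop of [eps / 2 * s]. *)
have near_eta : ball (g : arrow_uniform_type R E) (3 / 2 * s) eta.
  move=> t; rewrite -ball_normE/= distrC; apply: le_lt_trans (etag t) _; lra.
have es0 : 0 < eps * s by rewrite mulr_gt0.
have eta_low : path_height Phi eta <= M - eps / 2 * s.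
  apply: path_height_le => t t01; have [bt|bt] := leP b (Phi (g t)).
    have := etaK t t01 (conj t01 bt); have := path_height_ub Phic gpath t01.
    rewrite -/M hPhi /=; lra.
  have := etaJ t t01; move: sb bt; rewrite ler_pdivlMr// hPhi /=; lra.
have := gmin eta _ etaP (_ : 0 < 3 / 2 * s) near_eta.
have s32 : 0 < 3 / 2 * s by lra.
move=> /(_ s32); lra.
Unshelve. all: by end_near. Qed.
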